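(* Let $X=\ell_p(\mathbb{Z})$ $(1\le p<\infty)$ or $X=c_0(\mathbb{Z})$ over $\mathbb{K}\in\{\mathbb{R},\mathbb{C}\}$, let $w=(w_n)_{n\in\mathbb{Z}}$ be a bounded sequence in $\mathbb{K}$ with $\inf_{n\in\mathbb{Z}}|w_n|>0$, and let $B_w$ be the bilateral weighted backward shift on $X$ given by $w$. If the set of periodic points of $B_w$ is dense in $X$, then $B_w$ has the shadowing property if and only if it has the periodic shadowing property.
   Context: $B_w((x_n)_{n\in\mathbb{Z}})=(w_{n+1}x_{n+1})_{n\in\mathbb{Z}}$; under the assumptions on $w$ it is a bounded invertible operator on $X$. Let $T$ be an invertible bounded operator on a normed space $X$. A $\delta$-pseudotrajectory of $T$ is a sequence $(x_j)$ indexed by an interval of integers (at least two elements) with $\|Tx_j-x_{j+1}\|<\delta$ for all consecutive indices. A $\delta$-pseudotrajectory $(x_j)_{j\in\mathbb{Z}}$ is periodic if there is $p\in\mathbb{N}$ with $x_{j+p}=x_j$ for all $j\in\mathbb{Z}$. A point $x$ is periodic for $T$ if $T^px=x$ for some $p\in\mathbb{N}$. $T$ has the shadowing property if for every $\varepsilon>0$ there is $\delta>0$ such that for every $\delta$-pseudotrajectory $(x_j)_{j\in\mathbb{Z}}$ there is $x\in X$ with $\|x_j-T^jx\|<\varepsilon$ for all $j\in\mathbb{Z}$. $T$ has the periodic shadowing property if for every $\varepsilon>0$ there is $\delta>0$ such that for every periodic $\delta$-pseudotrajectory $(x_j)_{j\in\mathbb{Z}}$ there is a periodic point $x$ of $T$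 with $\|x_j-T^jx\|<\varepsilon$ for all $j\in\mathbb{Z}$. *)

(* Defs.v *)
From HB Require Import structures.
From mathcomp Require Import all_boot all_order all_algebra.
From mathcomp Require Import complex.
From mathcomp Require Import ring lra zify.
From mathcomp Require Import all_classical all_reals all_analysis.

Set Implicit Arguments.
Unset Strict Implicit.
Unset Printing Implicit Defensive.

Import Order.TTheory GRing.Theory Num.Theory.
Import numFieldNormedType.Exports.

Local Open Scope classical_set_scope.
Local Open Scope ring_scope.

Inductive scalars := RealScalars | ComplexScalars.

Definition scalar_field (R : realType) (k : scalars) : numFieldType :=
  match k with RealScalars => R | ComplexScalars => R[i] end.

Definition of_real (R : realType) (k : scalars) : R -> scalar_field R k :=
  match k return R -> scalar_field R k with
  | RealScalars => fun r => r
  | ComplexScalars => fun r => r%:C%C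
  end.

(* The norm `|z| of MathComp takes its values in the field itself, which for
   R[i] is not R; modulus is the same absolute value as an element of R
   (lemma normE). *)
Definition modulus (R : realType) (k : scalars) : scalar_field R k -> R :=
  match k return scalar_field R k -> R with
  | RealScalars => fun z => `|z|
  | ComplexScalars => fun z => complex.Re `|z|
  end.

Arguments of_real {R k} r.
Arguments modulus {R k} z.

Section scalar_theory.
Context {R : realType} {k : scalars}.
Implicit Types (z : scalar_field R k) (r : R).

Lemma normE z : `|z| = of_real (modulus z).
Proof. by case: k z => //= z; rewrite normc_def. Qed.

Lemma of_realD r s : of_real (r + s) = of_real r + of_real s :> scalar_field R k.
Proof. by case: k => //=; rewrite rmorphD. Qed.

Lemma of_realM r s : of_real (r * s) = of_real r * of_real s :> scalar_field R k.
Proof. by case: k => //=; rewrite rmorphM. Qed.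

Lemma of_real0 : of_real 0 = 0 :> scalar_field R k.
Proof. by case: k. Qed.

Lemma ler_of_real r s : (of_real r <= of_real s :> scalar_field R k) = (r <= s).
Proof. by case: k => //=; rewrite lecR. Qed.

Lemma of_real_inj : injective (of_real : R -> scalar_field R k).
Proof.
by move=> r s /eqP; rewrite eq_le !ler_of_real -eq_le => /eqP.
Qed.

Lemma modulus_ge0 z : 0 <= modulus z.
Proof. by rewrite -(ler_of_real 0) of_real0 -normE. Qed.

Lemma modulus0 : modulus (0 : scalar_field R k) = 0.
Proof. by apply: of_real_inj; rewrite -normE normr0 of_real0. Qed.

Lemma modulus0_eq0 z : modulus z = 0 -> z = 0.
Proof. by move=> z0; apply/eqP; rewrite -normr_eq0 normE z0 of_real0. Qed.

Lemma modulusM z t : modulus (z * t) = modulus z * modulus t.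
Proof. by apply: of_real_inj; rewrite of_realM -!normE normrM. Qed.

Lemma modulusD z t : modulus (z + t) <= modulus z + modulus t.
Proof. by rewrite -ler_of_real of_realD -!normE ler_normD. Qed.

End scalar_theory.

(* The two families of spaces: l_p(Z) with p real, 1 <= p, and c_0(Z). *)
Inductive seq_space (R : realType) :=
  | ellp (p : R) of 1 <= p
  | c_zero.
Arguments c_zero {R}.

(* Membership and norm only depend on the sequence a of moduli; for c_zero
   both tails of the two-sided sequence must tend to 0. *)
Definition mod_mem (R : realType) (E : seq_space R) (a : int -> R) : Prop :=
  match E with
  | ellp p _ => (\esum_(n in [set: int]) (a n `^ p)%:E < +oo)%E
  | c_zero => (a n%:Z @[n --> \oo] --> (0 : R)) /\
              (a (- n%:Z) @[n --> \oo] --> (0 : R))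
  end.

Definition mod_norm (R : realType) (E : seq_space R) (a : int -> R) : R :=
  match E with
  | ellp p _ => fine (\esum_(n in [set: int]) (a n `^ p)%:E) `^ p^-1
  | c_zero => sup (range a)
  end.

Section mod_theory.
Context {R : realType} (E : seq_space R).
Implicit Types a b : int -> R.

Lemma mod_mem_le a b : (forall n, 0 <= a n <= b n) ->
  mod_mem E b -> mod_mem E a.
Proof.
move=> ab; case: E => [p p1|] /=.
  apply: le_lt_trans; apply: le_esum => n _; rewrite lee_fin.
  have /andP[a0 anb] := ab n; have p0 : 0 <= p by rewrite (le_trans _ p1).
  by apply: ge0_ler_powR; rewrite ?nnegrE// (le_trans a0).
move=> [b1 b2].
by split; [apply: squeeze_cvgr (cvg_cst (0 : R)) b1
          |apply: squeeze_cvgr (cvg_cst (0 : R)) b2]; exact: nearW.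
Qed.

Lemma c_zero_ubound a : mod_mem c_zero a -> has_ubound (range a).
Proof.
move=> [/= a1 a2].
have [N1 _ h1] : \forall n \near \oo, a n%:Z < 1.
  by apply: (cvgr_lt 0) => //; exact: ltr01.
have [N2 _ h2] : \forall n \near \oo, a (- n%:Z) < 1.
  by apply: (cvgr_lt 0) => //; exact: ltr01.
pose M := 1 + \sum_(i < N1) `|a i%:Z| + \sum_(i < N2) `|a (- i%:Z)|.
have S1 : 0 <= \sum_(i < N1) `|a i%:Z| by apply: sumr_ge0.
have S2 : 0 <= \sum_(i < N2) `|a (- i%:Z)| by apply: sumr_ge0.
have b1 (n : nat) : a n%:Z <= M.
  have [nN|nN] := ltnP n N1; last first.
    by rewrite (le_trans (ltW (h1 n nN)))// /M -addrA lerDl addr_ge0.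
  rewrite /M (bigD1 (Ordinal nN))//= (le_trans (ler_norm _))//.
  rewrite addrAC addrCA lerDl !addr_ge0 //; exact: sumr_ge0.
have b2 (n : nat) : a (- n%:Z) <= M.
  have [nN|nN] := ltnP n N2; last first.
    by rewrite (le_trans (ltW (h2 n nN)))// /M -addrA lerDl addr_ge0.
  rewrite /M (bigD1 (Ordinal nN))//= (le_trans (ler_norm _))//.
  rewrite addrCA lerDl !addr_ge0 //; exact: sumr_ge0.
exists M => _ [n _ <-]; case: n => n; first exact: b1.
by rewrite NegzE; exact: b2.
Qed.

Lemma mod_norm_ge0 a : (forall n, 0 <= a n) -> mod_mem E a ->
  0 <= mod_norm E a.
Proof.
case: E => [p p1 _ _|a0 /c_zero_ubound ab] /=; first exact: powR_ge0.
by apply: le_trans (a0 0) _; apply: ub_le_sup => //; exists 0.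
Qed.

Lemma esum_powR_fin p a : (\esum_(n in [set: int]) (a n `^ p)%:E < +oo)%E ->
  \esum_(n in [set: int]) (a n `^ p)%:E \is a fin_num.
Proof.
move=> h; rewrite ge0_fin_numE//.
by apply: esum_ge0 => n _; rewrite lee_fin powR_ge0.
Qed.

Lemma mod_norm_le a b : (forall n, 0 <= a n <= b n) ->
  mod_mem E b -> mod_norm E a <= mod_norm E b.
Proof.
move=> ab mb; have ma := mod_mem_le ab mb; move: ma mb.
case: E => [p p1|] /= ma mb.
  have p0 : 0 <= p by rewrite (le_trans _ p1).
  have e0 c : 0 <= fine (\esum_(n in [set: int]) (c n `^ p)%:E).
    by apply/fine_ge0/esum_ge0 => n _; rewrite lee_fin powR_ge0.
  apply: ge0_ler_powR; rewrite ?nnegrE ?invr_ge0//.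
  apply: fine_le; rewrite ?esum_powR_fin//; last first.
  apply: le_esum => n _; rewrite lee_fin.
  have /andP[a0 anb] := ab n.
  by apply: ge0_ler_powR; rewrite ?nnegrE// (le_trans a0).
apply: sup_le_ub; first by exists (a 0), 0.
move=> _ [n _ <-]; have /andP[_ /le_trans ->//] := ab n.
by apply: ub_le_sup; [exact: c_zero_ubound | exists n].
Qed.

Lemma mod_le_norm a n : (forall n, 0 <= a n) -> mod_mem E a ->
  a n <= mod_norm E a.
Proof.
move=> a0; case: E => [p p1|] /= ma; last first.
  by apply: ub_le_sup; [exact: c_zero_ubound | exists n].
have p0 : 0 < p by rewrite (lt_le_trans _ p1).
have -> : a n = (a n `^ p) `^ p^-1.
  by rewrite -powRrM mulfV ?gt_eqF// powRr1.
have sa := esum_powR_fin ma.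
apply: ge0_ler_powR; rewrite ?nnegrE ?invr_ge0 ?(ltW p0) ?powR_ge0//.
  by apply/fine_ge0/esum_ge0 => m _; rewrite lee_fin powR_ge0.
rewrite -lee_fin fineK//; apply: esum_ge; exists [set n].
  by split=> //; exact: finite_set1.
by rewrite fsbig_set1.
Qed.

Lemma esumZ_le (c : R) (f : int -> \bar R) : 0 <= c ->
  (forall n, 0 <= f n)%E ->
  (\esum_(n in [set: int]) (c%:E * f n)
     <= c%:E * \esum_(n in [set: int]) f n)%E.
Proof.
move=> c0 f0; apply: ge_ereal_sup => _ [X [finX _] <-].
rewrite -ge0_mule_fsumr//; apply: lee_pmul => //; last first.
  by apply: ereal_sup_ubound; exists X.
by apply: fsume_ge0.
Qed.

Lemma mod_scale a (c : R) : 0 <= c -> (forall n, 0 <= a n) -> mod_mem E a ->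
  mod_mem E (fun n => c * a n) /\
  mod_norm E (fun n => c * a n) <= c * mod_norm E a.
Proof.
move=> c0 a0; case: E => [p p1|] /= ma; last first.
  split.
    case: ma => m1 m2.
    by split; rewrite -[X in _ --> X](mulr0 c);
      [exact: (cvgM (cvg_cst c) m1) | exact: (cvgM (cvg_cst c) m2)].
  apply: sup_le_ub; first by exists (c * a 0), 0.
  move=> _ [n _ <-]; apply: ler_wpM2l => //.
  by apply: ub_le_sup; [exact: c_zero_ubound | exists n].
have p0 : 0 < p by rewrite (lt_le_trans _ p1).
have sa := esum_powR_fin ma.
have le : (\esum_(n in [set: int]) ((c * a n) `^ p)%:E
    <= (c `^ p)%:E * \esum_(n in [set: int]) (a n `^ p)%:E)%E.
  under eq_esum do rewrite powRM// EFinM.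
  by apply: esumZ_le => [|n]; rewrite ?lee_fin powR_ge0.
have ltoo : (\esum_(n in [set: int]) ((c * a n) `^ p)%:E < +oo)%E.
  by apply: le_lt_trans le _; rewrite -(fineK sa) ltry.
split=> //; have sca := esum_powR_fin ltoo.
have cp : c = (c `^ p) `^ p^-1 by rewrite -powRrM mulfV ?gt_eqF// powRr1.
rewrite [X in _ <= X * _]cp.
have e0 b : 0 <= fine (\esum_(n in [set: int]) (b n `^ p)%:E).
  by apply/fine_ge0/esum_ge0 => n _; rewrite lee_fin powR_ge0.
rewrite -powRM ?powR_ge0//.
apply: ge0_ler_powR; rewrite ?nnegrE ?invr_ge0 ?(ltW p0) ?mulr_ge0 ?powR_ge0//.
by rewrite -lee_fin EFinM !fineK.
Qed.


Lemma mod_shift a (d : int) : (forall n, 0 <= a n) -> mod_mem E a ->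
  mod_mem E (fun n => a (n + d)) /\
  mod_norm E (fun n => a (n + d)) <= mod_norm E a.
Proof.
move=> a0; case: E => [p p1|] /= ma; last first.
  split; last first.
    apply: sup_le_ub; first by exists (a (0 + d)), 0.
    move=> _ [n _ <-].
    by apply: ub_le_sup; [exact: c_zero_ubound | exists (n + d)].
  have [m1 m2] := ma.
  have h (e : R) : 0 < e -> exists N : nat, forall n : int,
      (N <= `|n|)%N -> `|0 - a n| < e.
    move=> e0.
    move/cvgrPdist_lt : (m1) => /(_ e e0)[N1 _ h1].
    move/cvgrPdist_lt : (m2) => /(_ e e0)[N2 _ h2].
    exists (maxn N1 N2) => -[] n; rewrite geq_max => /andP[n1 n2].
      exact: (h1 n).
    by rewrite NegzE; exact: (h2 n.+1).
  split; apply/cvgrPdist_lt => e e0; have [N hN] := h e e0;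
    exists (N + `|d|)%N => // n /= nN; apply: hN; lia.
have bijd : set_bij [set: int] [set: int] (fun n => n + d).
  split=> //; first by move=> x y _ _ /addIr.
  by move=> y _; exists (y - d) => //; rewrite subrK.
rewrite -(reindex_esum _ _ _ (fun n => (a n `^ p)%:E) bijd).
by split.
Qed.

Lemma powR_convexD (p A B u v : R) : 1 <= p -> 0 < A -> 0 < B ->
  0 <= u -> 0 <= v ->
  (u + v) `^ p <= (A + B) `^ p *
    (A / (A + B) * (u / A) `^ p + B / (A + B) * (v / B) `^ p).
Proof.
move=> p1 A0 B0 u0 v0.
have AB0 : 0 < A + B by rewrite addr_gt0.
have t01 : 0 <= A / (A + B) <= 1.
  by rewrite divr_ge0 ?(ltW A0) ?(ltW AB0)//= ler_pdivrMr// mul1r lerDl ltW.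
have /andP[t0 t1] := t01.
have uA0 : 0 <= u / A by rewrite divr_ge0// ltW.
have vB0 : 0 <= v / B by rewrite divr_ge0// ltW.
have -> : u + v = (A + B) * (A / (A + B) * (u / A) + B / (A + B) * (v / B)).
  by field; rewrite !gt_eqF.
have q0 : 0 <= B / (A + B) by rewrite divr_ge0// ltW.
have c0 : 0 <= A / (A + B) * (u / A) + B / (A + B) * (v / B).
  by apply: addr_ge0; exact: mulr_ge0.
rewrite powRM ?(ltW AB0)//.
apply: ler_wpM2l; first exact: powR_ge0.
have -> : B / (A + B) = 1 - A / (A + B) by field; rewrite gt_eqF.
have := @convex_powR R p p1 (Itv01 t0 t1) (u / A) (v / B).
by rewrite !inE/= !in_itv/= !andbT !convRE/=; apply.
Qed.

Lemma mod_add a b : (forall n, 0 <= a n) -> (forall n, 0 <= b n) ->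
  mod_mem E a -> mod_mem E b ->
  mod_mem E (fun n => a n + b n) /\
  mod_norm E (fun n => a n + b n) <= mod_norm E a + mod_norm E b.
Proof.
move=> a0 b0 ma mb.
have na0 := mod_norm_ge0 a0 ma; have nb0 := mod_norm_ge0 b0 mb.
have za n := mod_le_norm n a0 ma; have zb n := mod_le_norm n b0 mb.
case: (E) ma mb na0 nb0 za zb => [p p1|] /= ma mb na0 nb0 za zb; last first.
  split.
    case: ma mb => m1 m2 [m1' m2'].
    by split; rewrite -[X in _ --> X](addr0 0);
      [exact: cvgD m1 m1' | exact: cvgD m2 m2'].
  apply: sup_le_ub; first by exists (a 0 + b 0), 0.
  by move=> _ [n _ <-]; rewrite lerD.
have p0 : 0 < p by rewrite (lt_le_trans _ p1).
have sa := esum_powR_fin ma; have sb := esum_powR_fin mb.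
have e0 c : 0 <= fine (\esum_(n in [set: int]) (c n `^ p)%:E).
  by apply/fine_ge0/esum_ge0 => n _; rewrite lee_fin powR_ge0.
set S := fun c : int -> R => fine (\esum_(n in [set: int]) (c n `^ p)%:E).
have key A B : 0 < A -> 0 < B ->
  (\esum_(n in [set: int]) ((a n + b n) `^ p)%:E <=
   ((A + B) `^ p * (A / (A + B) * (A^-1 `^ p * S a)
                  + B / (A + B) * (B^-1 `^ p * S b)))%:E)%E.
  move=> A0 B0.
  have AB0 : 0 < A + B by rewrite addr_gt0.
  pose cA := (A + B) `^ p * (A / (A + B)) * A^-1 `^ p.
  pose cB := (A + B) `^ p * (B / (A + B)) * B^-1 `^ p.
  have cA0 : 0 <= cA by rewrite !mulr_ge0 ?powR_ge0 ?invr_ge0// ltW.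
  have cB0 : 0 <= cB by rewrite !mulr_ge0 ?powR_ge0 ?invr_ge0// ltW.
  apply: (@le_trans _ _ (\esum_(n in [set: int])
     (cA%:E * (a n `^ p)%:E + cB%:E * (b n `^ p)%:E))%E).
    apply: le_esum => n _; rewrite -!EFinM -EFinD lee_fin.
    apply: le_trans (powR_convexD p1 A0 B0 (a0 n) (b0 n)) _.
    rewrite !powRM ?invr_ge0 ?(ltW A0) ?(ltW B0)//.
    by rewrite le_eqVlt; apply/orP; left; apply/eqP; rewrite /cA /cB; ring.
  rewrite esumD; try by move=> n _; rewrite -EFinM lee_fin mulr_ge0 ?powR_ge0.
  apply: le_trans (leeD (esumZ_le cA0 _) (esumZ_le cB0 _)) _;
    try by move=> n; rewrite lee_fin powR_ge0.
  rewrite -(fineK sa) -(fineK sb) -!EFinM -EFinD lee_fin -/(S a) -/(S b).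
  by rewrite le_eqVlt; apply/orP; left; apply/eqP; rewrite /cA /cB; ring.
have ltoo : (\esum_(n in [set: int]) ((a n + b n) `^ p)%:E < +oo)%E.
  by apply: le_lt_trans (key 1 1 ltr01 ltr01) _; rewrite ltry.
split=> //; have sab := esum_powR_fin ltoo.
have Sn c : S c = (S c `^ p^-1) `^ p.
  by rewrite -powRrM mulVf ?gt_eqF// powRr1// e0.
pose A := S a `^ p^-1; pose B := S b `^ p^-1.
have A0 : 0 <= A by exact: na0.
have B0 : 0 <= B by exact: nb0.
have aA n : a n <= A := za n; have bB n : b n <= B := zb n.
suff: S (fun n => a n + b n) `^ p^-1 <= A + B by exact.
have SA : S a = A `^ p := Sn a; have SB : S b = B `^ p := Sn b.
have AE : A = S a `^ p^-1 := erefl; have BE : B = S b `^ p^-1 := erefl.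
move: A B AE BE A0 B0 aA bB SA SB {na0 nb0 za zb Sn}.
move=> A B AE BE A0 B0 aA bB SA SB.
have [A1|A1] := eqVneq A 0.
  have -> : (fun n => a n + b n) = b.
    apply/funext => n; suff -> : a n = 0 by rewrite add0r.
    by apply/eqP; rewrite eq_le a0 -A1 aA.
  by rewrite -BE lerDr.
have [B1|B1] := eqVneq B 0.
  have -> : (fun n => a n + b n) = a.
    apply/funext => n; suff -> : b n = 0 by rewrite addr0.
    by apply/eqP; rewrite eq_le b0 -B1 bB.
  by rewrite -AE lerDl.
have {}A0 : 0 < A by rewrite lt0r A1.
have {}B0 : 0 < B by rewrite lt0r B1.
have := key _ _ A0 B0.
rewrite SA SB -!powRM ?invr_ge0 ?(ltW A0) ?(ltW B0)//.
rewrite !mulVf// powR1 !mulr1 -mulrDl mulfV ?gt_eqF ?addr_gt0// mulr1.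
rewrite -(fineK sab) lee_fin => le.
have -> : A + B = ((A + B) `^ p) `^ p^-1.
  by rewrite -powRrM mulfV ?gt_eqF// powRr1// ltW// addr_gt0.
apply: ge0_ler_powR; rewrite ?nnegrE ?invr_ge0 ?(ltW p0) ?powR_ge0//.
exact: e0.
Qed.

End mod_theory.

Section sequence_space.
Context {R : realType} {k : scalars}.

Definition mods (x : int -> (scalar_field R k)^o) : int -> R :=
  fun n => modulus (x n).

Definition in_space (E : seq_space R) : {pred int -> (scalar_field R k)^o} :=
  fun x => `[< mod_mem E (mods x) >].

Lemma mods_ge0 x n : 0 <= mods x n. Proof. exact: modulus_ge0. Qed.

Lemma in_spaceZ E (c : scalar_field R k) x : mod_mem E (mods x) ->
  mod_mem E (mods (c *: x)).
Proof.
move=> mx; have -> : mods (c *: x) = fun n => modulus c * mods x n.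
  by apply/funext => n; rewrite /mods modulusM.
by have [] := mod_scale (modulus_ge0 c) (mods_ge0 x) mx.
Qed.

Lemma in_space_submod E : submod_closed (in_space E).
Proof.
split.
  apply/asboolP; have -> : mods 0 = fun=> 0.
    by apply/funext => n; exact: modulus0.
  case: E => [p p1|] /=; last by split; exact: cvg_cst.
  rewrite esum1 ?ltry// => n _; rewrite powR0//.
  by rewrite gt_eqF// (lt_le_trans _ p1).
move=> c x y /asboolP mx /asboolP my; apply/asboolP.
have mcx := in_spaceZ c mx.
have [m _] := mod_add (mods_ge0 _) (mods_ge0 _) mcx my.
apply: mod_mem_le m => n; rewrite mods_ge0; exact: modulusD.
Qed.

HB.instance Definition _ (E : seq_space R) :=
  GRing.isSubmodClosed.Build _ _ (in_space E) (in_space_submod E).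

End sequence_space.

(* The Banach space of two-sided sequences named by E: it is made a
   normedModType below, with norm of_real (mod_norm E (mods x)). *)
Record seqsp (R : realType) (k : scalars) (E : seq_space R) :=
  Seqsp { seqsp_val :> int -> (scalar_field R k)^o; _ : seqsp_val \in in_space E }.

HB.instance Definition _ (R : realType) (k : scalars) (E : seq_space R) :=
  [isSub for @seqsp_val R k E].
HB.instance Definition _ (R : realType) (k : scalars) (E : seq_space R) :=
  [Choice of @seqsp R k E by <:].
HB.instance Definition _ (R : realType) (k : scalars) (E : seq_space R) :=
  [SubChoice_isSubLmodule of @seqsp R k E by <:].

Section norm.
Context {R : realType} {k : scalars} {E : seq_space R}.
Implicit Types x y : seqsp k E.

Definition seqsp_norm x : scalar_field R k := of_real (mod_norm E (mods x)).

Lemma seqsp_mem x : mod_mem E (mods x).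
Proof. by case: x => x /= /asboolP. Qed.

Lemma seqsp_normD x y : seqsp_norm (x + y) <= seqsp_norm x + seqsp_norm y.
Proof.
rewrite /seqsp_norm -of_realD ler_of_real.
have [m le] := mod_add (mods_ge0 _) (mods_ge0 _) (seqsp_mem x) (seqsp_mem y).
apply: le_trans le; apply: mod_norm_le m => n.
by rewrite mods_ge0; exact: modulusD.
Qed.

Lemma seqsp_normZ_le (c : scalar_field R k) x :
  seqsp_norm (c *: x) <= `|c| * seqsp_norm x.
Proof.
rewrite /seqsp_norm normE -of_realM ler_of_real.
have -> : mods (c *: x) = fun n => modulus c * mods x n.
  by apply/funext => n; rewrite /mods modulusM.
by have [] := mod_scale (modulus_ge0 c) (mods_ge0 x) (seqsp_mem x).
Qed.

Lemma seqsp_norm_eq0 x : seqsp_norm x = 0 -> x = 0.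
Proof.
rewrite /seqsp_norm -of_real0 => /of_real_inj x0.
apply/val_inj/funext => n; apply: modulus0_eq0; apply/eqP.
rewrite eq_le modulus_ge0 andbT -x0.
exact: mod_le_norm n (mods_ge0 _) (seqsp_mem x).
Qed.

Lemma seqsp_norm_ge0 x : 0 <= seqsp_norm x.
Proof.
rewrite /seqsp_norm -of_real0 ler_of_real.
exact: mod_norm_ge0 (mods_ge0 _) (seqsp_mem x).
Qed.

Lemma seqsp_normZ (c : scalar_field R k) x :
  seqsp_norm (c *: x) = `|c| * seqsp_norm x.
Proof.
apply/eqP; rewrite eq_le seqsp_normZ_le /=.
have [->|c0] := eqVneq c 0; first by rewrite normr0 mul0r seqsp_norm_ge0.
rewrite mulrC -ler_pdivlMr ?normr_gt0// mulrC -normfV.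
by rewrite -[in leLHS](scalerK c0 x) seqsp_normZ_le.
Qed.

End norm.

HB.instance Definition _ (R : realType) (k : scalars) (E : seq_space R) :=
  @Lmodule_isNormed.Build (scalar_field R k) (@seqsp R k E) seqsp_norm
    seqsp_normD seqsp_normZ seqsp_norm_eq0.


Section weighted_shift.
Context {R : realType} {k : scalars} {E : seq_space R}.

Lemma mult_shift_mem (v : int -> scalar_field R k) (M : R) (d : int)
    (x : seqsp k E) :
  (forall n, modulus (v n) <= M) ->
  (fun n => v n * x (n + d)) \in in_space E /\
  mod_norm E (mods (fun n => v n * x (n + d))) <= M * mod_norm E (mods x).
Proof.
move=> vM; have M0 : 0 <= M := le_trans (modulus_ge0 _) (vM 0).
have [m1 n1] := mod_shift d (mods_ge0 x) (seqsp_mem x).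
have [m2 n2] := mod_scale M0 (fun n => mods_ge0 x (n + d)) m1.
have le n : 0 <= mods (fun n => v n * x (n + d)) n <= M * mods x (n + d).
  by rewrite mods_ge0 /mods modulusM ler_wpM2r// modulus_ge0.
split; first by apply/asboolP; exact: mod_mem_le m2.
apply: le_trans (mod_norm_le le m2) (le_trans n2 _).
exact: ler_wpM2l.
Qed.

Variable w : int -> (scalar_field R k)^o.
Hypothesis w_bounded : bounded_fun w.
Hypothesis w_inf : 0 < inf (range (fun n => modulus (w n))).

Lemma w_modulus_le : exists M : R, forall n, modulus (w n) <= M.
Proof.
have [M0 [_ h]] := w_bounded.
have h1 n : `|w n| <= M0 + 1 by apply: h; rewrite ?ltrDl.
have M0_ge0 : 0 <= M0 + 1 := le_trans (normr_ge0 _) (h1 0).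
exists (modulus (M0 + 1)) => n.
by rewrite -(ler_of_real (k := k)) -!normE (ger0_norm M0_ge0).
Qed.

Lemma w_inf_le n : inf (range (fun n => modulus (w n))) <= modulus (w n).
Proof.
apply: ge_inf; last by exists n.
by exists 0 => _ [m _ <-]; exact: modulus_ge0.
Qed.

Lemma w_neq0 n : w n != 0.
Proof.
apply: contraTneq (w_inf_le n) => ->.
by rewrite modulus0 -ltNge.
Qed.

Lemma w_inv_modulus_le n :
  modulus (w n)^-1 <= (inf (range (fun n => modulus (w n))))^-1.
Proof.
have wn0 : 0 < modulus (w n) := lt_le_trans w_inf (w_inf_le n).
have -> : modulus (w n)^-1 = (modulus (w n))^-1.
  have wn1 : modulus (w n) != 0 by rewrite gt_eqF.
  apply: (mulfI wn1); rewrite -modulusM !mulfV ?w_neq0//.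
  by apply: (@of_real_inj R k); rewrite -normE normr1; case: (k).
by rewrite lef_pV2 ?posrE// w_inf_le.
Qed.

Lemma wshift_mem (x : seqsp k E) :
  (fun n => w (n + 1) * x (n + 1)) \in in_space E.
Proof.
have [M wM] := w_modulus_le.
by have [] := mult_shift_mem 1 x (fun n => wM (n + 1)).
Qed.

Lemma wshift_inv_mem (x : seqsp k E) :
  (fun n => (w n)^-1 * x (n - 1)) \in in_space E.
Proof. by have [] := mult_shift_mem (- 1) x w_inv_modulus_le. Qed.

Definition wshift_fun (x : seqsp k E) : seqsp k E := Seqsp (wshift_mem x).

(* The inverse of B_w; that it is one is wshiftK and wshift_invK. *)
Definition wshift_inv (x : seqsp k E) : seqsp k E := Seqsp (wshift_inv_mem x).

Lemma wshift_linear : linear wshift_fun.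
Proof.
by move=> c x y; apply/val_inj/funext => n /=; rewrite /= mulrDr mulrCA.
Qed.

Lemma wshift_bounded : exists M, forall x, `|wshift_fun x| <= M * `|x|.
Proof.
have [M wM] := w_modulus_le; exists (of_real M) => x.
rewrite /Num.norm/= /seqsp_norm -of_realM ler_of_real.
by have [] := mult_shift_mem 1 x (fun n => wM (n + 1)).
Qed.

Lemma wshift_inv_bounded : exists M, forall x, `|wshift_inv x| <= M * `|x|.
Proof.
exists (of_real (inf (range (fun n => modulus (w n))))^-1) => x.
rewrite /Num.norm/= /seqsp_norm -of_realM ler_of_real.
by have [] := mult_shift_mem (- 1) x w_inv_modulus_le.
Qed.

Lemma wshiftK : cancel wshift_fun wshift_inv.
Proof.
move=> x; apply/val_inj/funext => n /=.
by rewrite subrK mulKf// w_neq0.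
Qed.

Lemma wshift_invK : cancel wshift_inv wshift_fun.
Proof.
move=> x; apply/val_inj/funext => n /=.
by rewrite addrK mulVKf// w_neq0.
Qed.

End weighted_shift.

Record invertible_operator (K : numFieldType) (X : normedModType K) :=
  InvertibleOperator {
    iop_fun :> X -> X;
    iop_inv : X -> X;
    iop_linear : linear iop_fun;
    iop_bounded : exists M, forall x, `|iop_fun x| <= M * `|x|;
    iop_inv_bounded : exists M, forall x, `|iop_inv x| <= M * `|x|;
    iop_funK : cancel iop_fun iop_inv;
    iop_invK : cancel iop_inv iop_fun }.

Definition weighted_shift (R : realType) (k : scalars) (E : seq_space R)
    (w : int -> (scalar_field R k)^o) (w_bounded : bounded_fun w)
    (w_inf : 0 < inf (range (fun n => modulus (w n)))) :
    invertible_operator (seqsp k E) :=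
  InvertibleOperator (wshift_linear w_bounded) (wshift_bounded w_bounded)
    (wshift_inv_bounded w_inf) (wshiftK w_bounded w_inf)
    (wshift_invK w_bounded w_inf).
Arguments weighted_shift {R k} E {w} w_bounded w_inf.

Section shadowing.
Context {K : numFieldType} {X : normedModType K} (T : invertible_operator X).

Definition iop_pow (j : int) (x : X) : X :=
  match j with
  | Posz n => iter n T x
  | Negz n => iter n.+1 (iop_inv T) x
  end.

(* When K = R[i], an element d with 0 < d is a positive real number. *)
Definition pseudotrajectory (d : K) (x : int -> X) : Prop :=
  forall j : int, `|T (x j) - x (j + 1)| < d.

Definition periodic_seq (x : int -> X) : Prop :=
  exists2 p : nat, (0 < p)%N & forall j : int, x (j + p%:Z) = x j.

Definition periodic_point (x : X) : Prop :=
  exists2 p : nat, (0 < p)%N & iter p T x = x.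

Definition shadowing : Prop :=
  forall e : K, 0 < e -> exists2 d : K, 0 < d &
    forall x : int -> X, pseudotrajectory d x ->
      exists y : X, forall j : int, `|x j - iop_pow j y| < e.

Definition periodic_shadowing : Prop :=
  forall e : K, 0 < e -> exists2 d : K, 0 < d &
    forall x : int -> X, pseudotrajectory d x -> periodic_seq x ->
      exists2 y : X, periodic_point y &
        forall j : int, `|x j - iop_pow j y| < e.

End shadowing.

(* Main.v *)
Require Import Defs.
From mathcomp Require Import all_boot all_order all_algebra.
From mathcomp Require Import ring zify.
From mathcomp Require Import all_classical all_reals all_analysis.

(* Let pi n = w_1 ... w_n, with pi (n + 1) = w_(n + 1) pi n for all integers n,
   so that (T^j x)_i = pi (i + j) / pi i * x_(i + j), and let rho = |pi|.
   A periodic point with nonzero coordinate 0 shows that rho is bounded below.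
   As periodic points are dense, any finite pseudotrajectory from 0 can be closed
   into a periodic one, so either shadowing property shadows it.  Applied
   to a pseudotrajectory supported on one coordinate moving leftwards, this
   gives sum_(m - n <= i < m) rho i <= D (rho m + rho (m - n)).  With m or m - n
   equal to 0, rho (k) <= C t^l rho (k + l) and rho (- k) <= C t^l rho (- k - l)
   for some t < 1: T expands on the right half-line and contracts on the left
   one.  Then v_(j+1) = T v_j + z_j has, for every bounded z, a solution bounded
   by a multiple of the bound on z and periodic when z is, which yields both
   shadowing properties. *)

Set Implicit Arguments.
Unset Strict Implicit.
Unset Printing Implicit Defensive.

Import Order.TTheory GRing.Theory Num.Theory.
Import numFieldNormedType.Exports.

Local Open Scope classical_set_scope.
Local Open Scope ring_scope.

(** * Exhaustion and geometric series in the sequence spaces *)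

Section modulus_sequences.
Context {R : realType} (E : seq_space R).

(** For l_p, a finite set of indices lies in some window [|i| <= L], where [f <= F L], so the finite
    sums of [f i ^ p] are bounded by those of [F L]. For c_0, the bound [f <= F L + e] on all of Z
    passes the decay at infinity from [F L] to [f]. *)
Lemma mod_exhaust (F : nat -> int -> R) (f : int -> R) (D : R) :
  (forall i, 0 <= f i) ->
  (forall L i, (`|i| <= L)%N -> f i <= F L i) ->
  (forall e, 0 < e -> exists L, forall i, f i <= F L i + e) ->
  (forall L i, 0 <= F L i) ->
  (forall L, mod_mem E (F L) /\ mod_norm E (F L) <= D) ->
  mod_mem E f /\ mod_norm E f <= D.
Proof.
move=> f0 fF fFe F0 FD.
have D0 : 0 <= D by have [m] := FD 0%N; apply: le_trans; exact: mod_norm_ge0.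
have FleD L i : F L i <= D.
  by have [m] := FD L; apply: le_trans; exact: mod_le_norm.
case: E FD => [p p1|] FD /=; last first.
  split; last first.
    apply: ge_sup; first by exists (f 0), 0.
    by move=> _ [i _ <-]; exact: le_trans (fF _ _ (leqnn `|i|)) (FleD _ _).
  have tail (g : nat -> int) :
      (forall L, F L (g n) @[n --> \oo] --> 0) -> f (g n) @[n --> \oo] --> 0.
    move=> Fg; apply/cvgrPdist_lt => e e0.
    have e20 : 0 < e / 2 by rewrite divr_gt0.
    have [L fL] := fFe _ e20.
    move/cvgrPdist_lt : (Fg L) => /(_ _ e20); apply: filterS => n.
    rewrite !sub0r !normrN !ger0_norm// => FLn.
    by rewrite (le_lt_trans (fL _))// [ltRHS]splitr ltrD2r.
  by split; apply: tail => L; have [[]] := FD L.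
have p0 : 0 < p by rewrite (lt_le_trans _ p1).
suff le : (\esum_(n in [set: int]) (f n `^ p)%:E <= (D `^ p)%:E)%E.
  have ltoo : (\esum_(n in [set: int]) (f n `^ p)%:E < +oo)%E.
    by rewrite (le_lt_trans le) ?ltry.
  split=> //.
  have -> : D = (D `^ p) `^ p^-1 by rewrite -powRrM mulfV ?gt_eqF// powRr1.
  apply: ge0_ler_powR; rewrite ?nnegrE ?invr_ge0 ?(ltW p0) ?powR_ge0//.
    by apply/fine_ge0/esum_ge0 => m _; rewrite lee_fin powR_ge0.
  by rewrite -lee_fin fineK// esum_powR_fin.
apply: ge_ereal_sup => _ [X [finX _] <-].
pose L := \max_(i <- finmap.enum_fset (fset_set X)) `|i|%N.
have XL i : X i -> (`|i| <= L)%N.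
  by move=> Xi; apply: leq_bigmax_seq => //; rewrite in_fset_set// inE.
have [/= mL nL] := FD L.
apply: (@le_trans _ _ (\esum_(n in [set: int]) (F L n `^ p)%:E)%E).
  apply: esum_ge; exists X; first by split.
  apply: lee_fsum => // i Xi; rewrite lee_fin.
  by apply: ge0_ler_powR; rewrite ?nnegrE ?(ltW p0)//; exact/fF/XL.
rewrite -(fineK (esum_powR_fin mL)) lee_fin.
set S := fine _ in nL *.
have S0 : 0 <= S by apply/fine_ge0/esum_ge0 => m _; rewrite lee_fin powR_ge0.
have -> : S = (S `^ p^-1) `^ p by rewrite -powRrM mulVf ?gt_eqF// powRr1.
by apply: ge0_ler_powR; rewrite ?nnegrE ?powR_ge0 ?(ltW p0).
Qed.

Lemma geometric_sum_le (t : R) (m : nat) : 0 <= t < 1 ->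
  \sum_(l < m) t ^+ l <= (1 - t)^-1.
Proof.
move=> /andP[t0 t1]; have t10 : 0 < 1 - t by rewrite subr_gt0.
rewrite -[leRHS]mul1r ler_pdivlMr// mulrC -opprB mulNr -subrX1 opprB.
by rewrite gerBl exprn_ge0.
Qed.

(** The sums cut at a fixed number [L] of terms have norm at most [d / (1 - t)], and their
    remainders are at most [t ^ L * d / (1 - t)] uniformly in [i], so [mod_exhaust] applies. The
    upper limit |i| is the number of terms in coordinate [i] of [green]. *)
Lemma mod_geometric (a : nat -> int -> R) (t d : R) : 0 <= t < 1 ->
  (forall l i, 0 <= a l i) ->
  (forall l, mod_mem E (a l) /\ mod_norm E (a l) <= d) ->
  mod_mem E (fun i => \sum_(l < `|i|) t ^+ l * a l i) /\
  mod_norm E (fun i => \sum_(l < `|i|) t ^+ l * a l i) <= d / (1 - t).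
Proof.
move=> t01 a0 ad; have /andP[t0 t1] := t01.
have d0 : 0 <= d by have [m] := ad 0%N; apply: le_trans; exact: mod_norm_ge0.
have ald l i : a l i <= d.
  by have [m] := ad l; apply: le_trans; exact: mod_le_norm.
have ta0 l i : 0 <= t ^+ l * a l i by rewrite mulr_ge0// exprn_ge0.
pose F L i := \sum_(l < L) t ^+ l * a l i.
have F0 L i : 0 <= F L i by exact: sumr_ge0.
have FS L : F L.+1 = fun i => F L i + t ^+ L * a L i.
  by apply/funext => i; rewrite /F big_ord_recr.
have FD L : mod_mem E (F L) /\ mod_norm E (F L) <= d * \sum_(l < L) t ^+ l.
  elim: L => [|L [m n]].
    rewrite big_ord0 mulr0.
    have [m n] := mod_scale (lexx 0) (a0 0%N) (ad 0%N).1.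
    have -> : F 0%N = fun i => 0 * a 0%N i.
      by apply/funext => i; rewrite /F big_ord0 mul0r.
    by rewrite mul0r in n.
  rewrite FS.
  have [m1 n1] := mod_scale (exprn_ge0 L t0) (a0 L) (ad L).1.
  have [m2 n2] := mod_add (F0 L) (ta0 L) m m1.
  split=> //; apply: le_trans n2 _; rewrite big_ord_recr/= mulrDr lerD//.
  by rewrite (le_trans n1)// mulrC ler_wpM2r ?exprn_ge0//; exact: (ad L).2.
have F_tail L m i : F (L + m)%N i <= F L i + t ^+ L * (d / (1 - t)).
  rewrite /F big_split_ord/= lerD2l.
  apply: (@le_trans _ _ (t ^+ L * (d * \sum_(l < m) t ^+ l))).
    rewrite mulrA mulr_sumr; apply: ler_sum => l _.
    by rewrite exprD mulrAC ler_wpM2r ?exprn_ge0// ler_wpM2l ?exprn_ge0.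
  by rewrite ler_wpM2l ?exprn_ge0// ler_wpM2l// geometric_sum_le.
have F_mono L m i : (m <= L)%N -> F m i <= F L i.
  by move=> /subnKC <-; rewrite /F big_split_ord/= lerDl sumr_ge0.
apply: (@mod_exhaust F) => //.
- by move=> i; exact: sumr_ge0.
- by move=> L i; exact: F_mono.
- move=> e e0; set c := d / (1 - t) in F_tail.
  have c0 : 0 <= c by rewrite divr_ge0// subr_ge0 ltW.
  clearbody c.
  have tc : (t ^+ n * c) @[n --> \oo] --> 0.
    rewrite -(mul0r c); apply: cvgM; last exact: cvg_cst.
    by apply: cvg_expr; rewrite ger0_norm.
  move/cvgrPdist_lt : tc => /(_ e e0)[L _ /(_ L (leqnn L))].
  rewrite sub0r normrN ger0_norm ?mulr_ge0 ?exprn_ge0// => /ltW tce.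
  (* At coordinate [i] the full sum has |i| terms; enlarging it to [L + |i|] terms makes it
     comparable with [F L]. *)
  exists L => i; apply: le_trans (F_mono (L + `|i|)%N _ _ (leq_addl _ _)) _.
  by apply: le_trans (F_tail _ _ _) _; rewrite lerD2l.
- move=> L; have [m n] := FD L; split=> //; apply: le_trans n _.
  by rewrite ler_wpM2l// geometric_sum_le.
Qed.

(* If S_i is the sum of r_k for k <= i, then S_i <= (C + 1)(S_i - S_(i-1)), so
   the partial sums grow at least geometrically. *)
Lemma sum_le_geometric (r : nat -> R) (C : R) : 0 <= C ->
  (forall i, 0 <= r i) -> (forall i, \sum_(k < i) r k <= C * r i) ->
  forall k l, r k <= (C + 1) * (C / (C + 1)) ^+ l * r (k + l)%N.
Proof.
move=> C0 r0 rC k l; have C10 : 0 < C + 1 by rewrite ltr_wpDl.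
pose S i := \sum_(j < i) r j.
have SC i : S i <= C / (C + 1) * S i.+1.
  rewrite /S big_ord_recr/= -/(S i) mulrAC ler_pdivlMr//.
  by rewrite mulrDr mulrDr mulr1 mulrC lerD2l; exact: rC.
have SCl : S k.+1 <= (C / (C + 1)) ^+ l * S (k + l).+1.
  elim: l => [|l IH]; first by rewrite addn0 mul1r.
  apply: le_trans IH _; rewrite exprSr -mulrA addnS.
  by rewrite ler_wpM2l// exprn_ge0// divr_ge0// ltW.
have Sr i : S i.+1 <= (C + 1) * r i.
  by rewrite /S big_ord_recr/= mulrDl mul1r lerD2r; exact: rC.
apply: (@le_trans _ _ (S k.+1)); first by
  rewrite /S big_ord_recr/= lerDr sumr_ge0.
apply: le_trans SCl _; rewrite [leRHS]mulrAC [leRHS]mulrC.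
by rewrite ler_wpM2l ?Sr// exprn_ge0// divr_ge0// ltW.
Qed.

End modulus_sequences.

(** * Orbits and periodic pseudotrajectories of an invertible operator *)

Section operators.
Context {K : numFieldType} {X : normedModType K} (T : invertible_operator X).
Implicit Types (x y : X).

Lemma iop_sub x y : T (x - y) = T x - T y.
Proof.
by rewrite addrC -scaleN1r; have -> := iop_linear T (-1) y x;
  rewrite scaleN1r addrC.
Qed.

Lemma iop_scale (c : K) x : T (c *: x) = c *: T x.
Proof.
have T0 : T 0 = 0 by have := iop_sub 0 0; rewrite !subrr.
by have := iop_linear T c x 0; rewrite T0 !addr0.
Qed.

Lemma iop_powS (j : int) x : iop_pow T (j + 1) x = T (iop_pow T j x).
Proof.
case: j => [n|[|n]]; first by rewrite -PoszD addn1.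
  by rewrite NegzE addNr /= iop_invK.
have -> : Negz n.+1 + 1 = Negz n by lia.
by rewrite /= iop_invK.
Qed.

Lemma iop_pow_orbit (x : int -> X) : (forall j, x (j + 1) = T (x j)) ->
  forall j, x j = iop_pow T j (x 0).
Proof.
move=> xT; elim/int_ind => [//|n IH|n IH].
  by rewrite -addn1 PoszD xT IH iop_powS.
apply: (can_inj (iop_funK T)); rewrite -xT -iop_powS.
by have -> : - n.+1%:Z + 1 = - n%:Z by lia.
Qed.

(** Time is reduced modulo [L]; the return from [L - 1] to 0 is an admissible step because
    [g L = g 0]. *)
Lemma periodic_loop (d : K) (L : nat) (g : nat -> X) : (0 < L)%N ->
  g L = g 0%N -> (forall j, (j < L)%N -> `|T (g j) - g j.+1| < d) ->
  exists x : int -> X, [/\ pseudotrajectory T d x, periodic_seq x &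
    forall j : nat, (j <= L)%N -> x j = g j].
Proof.
move=> L0 gL gd; exists (fun j => g `|(j %% L)%Z|%N); split.
- move=> j; have Lp : 0 < L%:Z by lia.
  have Ln : L%:Z != 0 by lia.
  have [r0 rL] := (modz_ge0 j Ln, ltz_pmod j Lp).
  rewrite -modzDml; move: (j %% L)%Z r0 rL => [r _|//]; rewrite ltz_nat => rL.
  rewrite -PoszD addn1 modz_nat !absz_nat.
  have := gd _ rL; have [->|] := eqVneq r.+1 L; first by rewrite modnn gL.
  by move=> rL'; rewrite modn_small// ltn_neqAle rL'.
- by exists L => // j; rewrite modzDr.
- move=> j; rewrite leq_eqVlt modz_nat absz_nat => /predU1P[->|jL].
    by rewrite modnn gL.
  by rewrite modn_small.
Qed.

End operators.

Lemma mulf_div_cancel (F : fieldType) (a b c : F) :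
  a != 0 -> a * (b / (a * c)) = b / c.
Proof. by move=> a0; rewrite invfM !mulrA [a * b]mulrC mulfK. Qed.

(** * Moduli of real and complex scalars *)

Section scalars.
Context {R : realType} {k : scalars}.
Implicit Types (z : scalar_field R k) (r : R).

Lemma ltr_of_real r s : (of_real r < of_real s :> scalar_field R k) = (r < s).
Proof. by rewrite !lt_def ler_of_real (inj_eq (@of_real_inj _ _)). Qed.

Lemma modulus_of_real r : 0 <= r -> modulus (of_real r : scalar_field R k) = r.
Proof.
move=> r0; apply: (@of_real_inj R k).
by rewrite -normE ger0_norm// -of_real0 ler_of_real.
Qed.

(** A positive scalar equals its own norm, which is real; tolerances can thus be handled in [R]. *)
Lemma scalar_gt0P z : 0 < z -> exists2 r : R, 0 < r & z = of_real r.
Proof.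
move=> z0; exists (modulus z); last by rewrite -normE gtr0_norm.
by rewrite -ltr_of_real -normE of_real0 normr_gt0 gt_eqF.
Qed.

Lemma modulus_gt0 z : z != 0 -> 0 < modulus z.
Proof.
by move=> z0; rewrite -(ltr_of_real 0) of_real0 -normE normr_gt0.
Qed.

Lemma of_real1 : of_real 1 = 1 :> scalar_field R k.
Proof. by case: (k). Qed.

Lemma modulus1 : modulus (1 : scalar_field R k) = 1.
Proof. by rewrite -of_real1 modulus_of_real. Qed.

Lemma modulusV z : modulus z^-1 = (modulus z)^-1.
Proof.
have [->|z0] := eqVneq z 0; first by rewrite invr0 modulus0 invr0.
have z1 : modulus z != 0 by rewrite gt_eqF ?modulus_gt0.
by apply: (mulfI z1); rewrite -modulusM !mulfV// modulus1.
Qed.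

Lemma modulusN z : modulus (- z) = modulus z.
Proof. by apply: (@of_real_inj R k); rewrite -!normE normrN. Qed.

Lemma modulus_sum (I : Type) (s : seq I) (f : I -> scalar_field R k) :
  modulus (\sum_(i <- s) f i) <= \sum_(i <- s) modulus (f i).
Proof.
elim/big_rec2 : _ => [|i r z _ le]; first by rewrite modulus0.
by rewrite (le_trans (modulusD _ _))// lerD2l.
Qed.

Lemma scalar_archimedean (b d : scalar_field R k) : 0 <= b -> 0 < d ->
  exists N : nat, b < d *+ N.
Proof.
move=> b0 /scalar_gt0P[r r0 ->].
have -> : b = of_real (modulus b) by rewrite -normE ger0_norm.
have /archi_boundP : 0 <= modulus b / r by rewrite divr_ge0 ?modulus_ge0 ?ltW.
rewrite ltr_pdivrMr// => lt; exists (Num.Def.archi_bound (modulus b / r)).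
have -> N : of_real r *+ N = of_real (N%:R * r) :> scalar_field R k.
  elim: N => [|N IH]; first by rewrite mul0r of_real0.
  by rewrite mulrS IH -of_realD -natr1 mulrDl mul1r addrC.
by rewrite ltr_of_real.
Qed.

End scalars.

(** * Coordinate vectors and approximation *)

Section coordinates.
Context {R : realType} {k : scalars} {E : seq_space R}.
Implicit Types x : seqsp k E.

Lemma seqsp_normE x : `|x| = of_real (mod_norm E (mods x)).
Proof. by []. Qed.

Lemma modulus_le_norm x i : modulus (x i) <= mod_norm E (mods x).
Proof. exact: mod_le_norm i (mods_ge0 _) (seqsp_mem x). Qed.

Lemma mod_mem_single (i : int) (c : R) : 0 <= c ->
  mod_mem E (fun n => if n == i then c else 0) /\
  mod_norm E (fun n => if n == i then c else 0) <= c.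
Proof.
move=> c0; pose a n := if n == i then c else 0; rewrite -/a.
have a0 n : 0 <= a n by rewrite /a; case: ifP.
case: E => [p p1|] /=; last first.
  split; last first.
    apply: ge_sup; first by exists (a 0), 0.
    by move=> _ [n _ <-]; rewrite /a; case: ifP.
  by split; apply: cvg_near_cst; exists `|i|.+1 => // n /= nN;
    rewrite /a ifF//; apply/negbTE/eqP; lia.
have p0 : 0 < p by rewrite (lt_le_trans _ p1).
have -> : \esum_(n in [set: int]) (a n `^ p)%:E = (c `^ p)%:E.
  rewrite (esumID [set i]); last first.
    by move=> n _; rewrite lee_fin powR_ge0.
  rewrite !setTI esum_set1 ?lee_fin ?powR_ge0// esum1 ?adde0 /a ?eqxx//.
  by move=> n /= /eqP/negbTE ->; rewrite powR0 ?gt_eqF.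
split; first by rewrite ltry.
by rewrite /= -powRrM mulfV ?gt_eqF// powRr1.
Qed.

Lemma single_in_space (i : int) (c : scalar_field R k) :
  (fun n => if n == i then c else 0) \in in_space (k := k) E.
Proof.
apply/asboolP; have [m _] := mod_mem_single i (modulus_ge0 c).
by apply: mod_mem_le m => n; rewrite mods_ge0 /mods /=; case: ifP => // _;
  rewrite modulus0.
Qed.

Definition single i c : seqsp k E := Seqsp (single_in_space i c).

Lemma singleE i c n : single i c n = if n == i then c else 0.
Proof. by []. Qed.

Lemma norm_single_le i c : `|single i c| <= of_real (modulus c).
Proof.
rewrite seqsp_normE ler_of_real.
have [m n] := mod_mem_single i (modulus_ge0 c); apply: le_trans n.
by apply: mod_norm_le m => n; rewrite mods_ge0 /mods /=; case: ifP => // _;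
  rewrite modulus0.
Qed.

Lemma dense_approx (P : set (seqsp k E)) x (e : scalar_field R k) :
  dense P -> 0 < e -> exists2 u, P u & `|x - u| < e.
Proof.
move=> dP e0; have [|u [xu Pu]] := dP (ball x e) _ (ball_open x e).
  by exists x; exact: ballxx.
by exists u => //; move: xu; rewrite -ball_normE.
Qed.

End coordinates.

(** * Products of weights and iterates of the shift *)

Section weight_products.
Context {R : realType} {k : scalars} {E : seq_space R}.
Context {w : int -> (scalar_field R k)^o} (w_bounded : bounded_fun w)
  (w_inf : 0 < inf (range (fun n => modulus (w n)))).
Local Notation T := (weighted_shift E w_bounded w_inf).
Implicit Types x : seqsp k E.

(** For negative [n] this is the inverse of w_0 w_(-1) ... w_(n+1), as the recursion [wprodS] forces
    when continued to the left of 0. *)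
Definition wprod (n : int) : scalar_field R k :=
  match n with
  | Posz n => \prod_(i < n) w i.+1%:Z
  | Negz n => (\prod_(i < n.+1) w (- i%:Z))^-1
  end.

Lemma wprod0 : wprod 0 = 1.
Proof. by rewrite /= big_ord0. Qed.

Lemma wprod_neq0 n : wprod n != 0.
Proof.
by case: n => n /=; rewrite ?invr_eq0; apply/prodf_neq0 => i _; exact: w_neq0.
Qed.

Lemma wprodS n : wprod (n + 1) = w (n + 1) * wprod n.
Proof.
case: n => [n|[|n]]; first by rewrite -PoszD addn1 /= big_ord_recr mulrC.
  by rewrite NegzE addNr /= big_ord0 big_ord1 mulfV ?w_neq0.
have -> : Negz n.+1 + 1 = Negz n by lia.
rewrite [wprod (Negz n.+1)]/= big_ord_recr invfM/=.
have -> : Negz n = - n.+1%:Z by lia.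
by rewrite [RHS]mulrCA mulfV ?w_neq0// mulr1.
Qed.

(** Multiplying each coordinate [i] by [wprod i] conjugates the weighted shift to the plain one. *)
Lemma shift_powE j x i :
  iop_pow T j x i = wprod (i + j) / wprod i * x (i + j).
Proof.
have cancel n b y : w n * (b / wprod n * y) = b / wprod (n - 1) * y.
  rewrite -{2}(subrK 1 n) wprodS subrK.
  by rewrite mulrA (@mulf_div_cancel (scalar_field R k)) ?w_neq0.
pose v (j : int) : seqsp k E := iop_pow T j x.
have vS l n : v (l + 1) n = w (n + 1) * v l (n + 1) by rewrite /v iop_powS.
rewrite -/(v j); elim/int_ind : j i => [i|j IH i|j IH i].
- by rewrite addr0 divff ?wprod_neq0// mul1r.
- by rewrite -addn1 PoszD vS IH cancel addrK -addrA [1 + _]addrC.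
(* Multiplied by [w i], coordinate [i] becomes coordinate [i - 1] of the next iterate, which the
   induction hypothesis gives. *)
- apply: (mulfI (w_neq0 w_inf i)); rewrite cancel.
  have := vS (- j.+1%:Z) (i - 1); rewrite subrK => <-.
  have -> : - j.+1%:Z + 1 = - j%:Z by lia.
  by rewrite IH; have -> : i - j.+1%:Z = i - 1 - j%:Z by lia.
Qed.

End weight_products.

Arguments wprod : simpl never.

(** * From shadowing to geometric growth of the weight products *)

Section dichotomy.
Context {R : realType} {k : scalars} {E : seq_space R}.
Context {w : int -> (scalar_field R k)^o} (w_bounded : bounded_fun w)
  (w_inf : 0 < inf (range (fun n => modulus (w n)))).
Local Notation T := (weighted_shift E w_bounded w_inf).
Local Notation rho n := (modulus (wprod (w := w) n)).
Hypothesis periodic_dense : dense [set x : seqsp k E | periodic_point T x].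

(* Once at a point close to a periodic u, one walks down to 0 along
   (1 - s/N) T^s u; each step has error |T^(s+1) u| / N. *)
Lemma periodic_closing (d : scalar_field R k) (n : nat) (c : nat -> seqsp k E) :
  0 < d -> c 0%N = 0 -> (forall j, (j < n)%N -> `|T (c j) - c j.+1| < d) ->
  exists x : int -> seqsp k E, [/\ pseudotrajectory T d x, periodic_seq x &
    forall j : nat, (j <= n)%N -> x j = c j].
Proof.
move=> d0 c0 cd.
(* Jumping from [c n] to [u] is an admissible step, as [u] is within [d] of [T (c n)]. *)
have [u [q q0 uq] ud] := dense_approx (T (c n)) periodic_dense d0.
(* One period contains the whole orbit of [u], so [B] bounds all its norms; [N] will make [B / N]
   less than [d]. *)
pose B := \sum_(i < q) `|iter i T u|.
have B0 : 0 <= B by exact: sumr_ge0.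
have uB s : `|iter s T u| <= B.
  elim/ltn_ind: s => s IH; have [sq|qs] := ltnP s q.
    by rewrite /B (bigD1 (Ordinal sq))//= lerDl sumr_ge0.
  by rewrite -(subnK qs) iterD uq IH// ltn_subrL q0 (leq_trans q0).
have [N BN] := scalar_archimedean B0 d0.
have N0 : (0 < N)%N by case: N BN => //; rewrite mulr0n => /lt_geF; rewrite B0.
have NR0 : 0 < N%:R :> scalar_field R k by rewrite ltr0n.
pose g j := if (j <= n)%N then c j else
  ((N - (j - n.+1))%:R / N%:R : scalar_field R k) *: iter (j - n.+1) T u.
have gE s : g (n.+1 + s)%N =
    ((N - s)%:R / N%:R : scalar_field R k) *: iter s T u.
  by rewrite /g leqNgt ltn_addr// addKn.
have [||j jL|x [xd xp xg]] := @periodic_loop _ _ T d (n.+1 + N)%N g.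
- by [].
- by rewrite gE subnn mul0r scale0r /g leq0n c0.
- have [jn|nj] := leqP j n; last first.
    rewrite -(subnKC nj) -addnS !gE; set s := (j - n.+1)%N.
    have sN : (s < N)%N by rewrite /s; lia.
    rewrite iop_scale -iterS -scalerBl -mulrBl -natrB; last by lia.
    have -> : (N - s - (N - s.+1) = 1)%N by lia.
    rewrite normrZ ger0_norm ?divr_ge0// mul1r mulrC ltr_pdivrMr//.
    by rewrite mulr_natr; exact: le_lt_trans (uB _) BN.
  rewrite {1}/g jn; have [jn'|nj'] := ltnP j n; first by rewrite /g jn' cd.
  have -> : j = n by apply/eqP; rewrite eqn_leq jn.
  by rewrite -[n.+1]addn0 gE subn0 divff ?gt_eqF// scale1r.
exists x; split=> // j jn; rewrite xg /g ?jn//.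
by rewrite (leq_trans jn)// (leq_trans (leqnSn n)) ?leq_addr.
Qed.

Lemma shift_single i (c : scalar_field R k) :
  T (single i c) = single (i - 1) (w i * c).
Proof.
apply/val_inj/funext => n; rewrite /= [n == i - 1]eq_sym subr_eq [i == _]eq_sym.
by case: eqP => [->|]; rewrite ?mulr0.
Qed.

Lemma single_sub i (a b : scalar_field R k) :
  single i a - single i b = single i (a - b) :> seqsp k E.
Proof.
apply/val_inj/funext => n /=.
rewrite -[LHS]/((if n == i then a else 0) - (if n == i then b else 0)).
by case: ifP; rewrite ?subr0.
Qed.

(* The test pseudotrajectory is A_j / pi(m - j) e_(m - j), where A_j is the sum
   of d/2 rho(i) over m - j <= i < m; only its two ends are used. *)
Lemma shadowing_sum_le (d : scalar_field R k) : 0 < d ->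
  (forall x, pseudotrajectory T d x -> periodic_seq x ->
    exists y, forall j : int, `|x j - iop_pow T j y| < 1) ->
  exists2 D : R, 0 <= D & forall (m : int) (n : nat),
    \sum_(j < n) rho (m - 1 - j%:Z) <= D * (rho m + rho (m - n%:Z)).
Proof.
move=> d0 shad; have [r r0 dE] := scalar_gt0P d0.
exists (2 / r) => [|m n]; first by rewrite divr_ge0// ltW.
pose A (j : nat) : R := \sum_(i < j) (r / 2 * rho (m - 1 - i%:Z)).
have A0 j : 0 <= A j.
  by apply: sumr_ge0 => i _; rewrite mulr_ge0 ?modulus_ge0// divr_ge0// ltW.
pose c (j : nat) : seqsp k E :=
  single (m - j%:Z) (of_real (A j) / wprod (w := w) (m - j%:Z)).
have [||j jn|x [xd xp xc]] := @periodic_closing d n c.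
- by [].
- apply/val_inj/funext => i; rewrite /= /A big_ord0 of_real0 mul0r.
  by case: ifP.
- rewrite /c shift_single.
  have -> : m - j%:Z - 1 = m - j.+1%:Z by lia.
  have -> : w (m - j%:Z) * (of_real (A j) / wprod (w := w) (m - j%:Z)) =
      of_real (A j) / wprod (w := w) (m - j.+1%:Z).
    have := wprodS w_inf (m - j.+1%:Z).
    have -> : m - j.+1%:Z + 1 = m - j%:Z by lia.
    by move=> ->; apply: mulf_div_cancel; exact: w_neq0.
  rewrite single_sub -mulrBl.
  (* Only the new summand of [A] survives; divided by [wprod (m - j.+1)] it leaves an error of
     modulus [r / 2]. *)
  have -> : of_real (A j) - of_real (A j.+1) =
      - of_real (r / 2 * rho (m - j.+1%:Z)) :> scalar_field R k.
    rewrite /A big_ord_recr/= of_realD opprD addNKr.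
    by have -> : m - 1 - j%:Z = m - j.+1%:Z by lia.
  apply: le_lt_trans (norm_single_le _ _) _.
  rewrite modulusM modulusN modulusV modulus_of_real; last first.
    by rewrite mulr_ge0 ?modulus_ge0// divr_ge0// ltW.
  rewrite mulfK; last by rewrite gt_eqF ?modulus_gt0 ?wprod_neq0.
  by rewrite dE ltr_of_real ltr_pdivrMr// mulr_natr mulr2n ltrDl.
have [y xy] := shad x xd xp.
(* Multiplied by [wprod (m - j)], coordinate [m - j] of the orbit of [y] at time [j] is
   [wprod m * y m] for every [j]. *)
have coord (j : nat) : (j <= n)%N ->
    A j <= rho (m - j%:Z) + rho m * modulus (y m).
  move=> jn; have := xy j; rewrite xc// seqsp_normE -[ltRHS]of_real1.
  rewrite ltr_of_real => lt1.
  have := le_lt_trans (modulus_le_norm _ (m - j%:Z)) lt1.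
  rewrite -[(c j - iop_pow T j y) _]/
    (c j (m - j%:Z) - iop_pow T j y (m - j%:Z)).
  rewrite shift_powE subrK /c singleE eqxx.
  set p := wprod (m - j%:Z); have p0 : p != 0 by rewrite wprod_neq0.
  rewrite mulrAC -mulrBl modulusM modulusV ltr_pdivrMr ?modulus_gt0// mul1r.
  move=> /ltW le; rewrite -[leLHS](modulus_of_real (k := k))// -modulusM.
  rewrite -[of_real _](subrK (wprod (w := w) m * y m)).
  by apply: le_trans (modulusD _ _) _; rewrite lerD2r.
(* At time 0 the pseudotrajectory vanishes, since [A 0] is an empty sum. *)
have y1 : modulus (y m) <= 1.
  have := xy 0; rewrite xc// seqsp_normE -[ltRHS]of_real1.
  rewrite ltr_of_real => lt1.
  have := le_lt_trans (modulus_le_norm _ m) lt1.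
  rewrite -[(c 0%N - iop_pow T 0 y) _]/(c 0%N m - y m) /c singleE.
  rewrite /A big_ord0 of_real0 mul0r; case: ifP => _; rewrite sub0r modulusN;
  exact: ltW.
rewrite mulrAC ler_pdivlMr// mulrC.
have -> : r * \sum_(j < n) rho (m - 1 - j%:Z) = 2 * A n.
  by rewrite /A -mulr_sumr mulrA mulrCA mulfV ?mulr1.
rewrite ler_pM2l// (le_trans (coord n (leqnn n)))// addrC lerD2r.
by rewrite ler_piMr// modulus_ge0.
Qed.

(** A periodic point [u] near [single 0 1] has [u 0 != 0]. If [q] is its period, [wprod i * u i] is
    [q]-periodic in [i], so [rho] is at least [|u 0| / |u|] at the multiples of [q]; bounded weights
    carry this to the other indices. *)
Lemma wprod_bounded_below : exists2 c : R, 0 <= c & forall i, 1 <= c * rho i.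
Proof.
have [u [q q0 uq] ud] := dense_approx (single 0 1) periodic_dense ltr01.
have u0 : 0 < modulus (u 0).
  apply: modulus_gt0; apply: contraTneq ud => u0.
  rewrite seqsp_normE -[ltRHS]of_real1 ltr_of_real -leNgt.
  apply: le_trans (modulus_le_norm _ 0).
  rewrite -[(_ - u) 0]/(1 - u 0) u0 subr0 modulus1.
  exact: lexx.
have gq i : wprod (w := w) (i + q%:Z) * u (i + q%:Z) = wprod (w := w) i * u i.
  have := shift_powE w_bounded w_inf q u i; rewrite /= uq => ->.
  by rewrite -mulrA mulrCA mulVKf// wprod_neq0.
have gaq a : wprod (w := w) (a * q%:Z) * u (a * q%:Z) = u 0.
  elim/int_ind : a => [|a IH|a IH].
  - by rewrite mul0r wprod0 mul1r.
  - by rewrite -addn1 PoszD mulrDl mul1r gq.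
  - rewrite -gq; have -> : - a.+1%:Z * q%:Z + q%:Z = - a%:Z * q%:Z by lia.
    exact: IH.
have [M0 wM0] := w_modulus_le w_bounded.
(* The maximum with 1 makes the powers of [M] nondecreasing, so [M ^ s <= M ^ q]. *)
pose M := Num.max 1 M0.
have M1 : 1 <= M by rewrite le_max lexx.
have M_ge0 : 0 <= M by rewrite (le_trans ler01).
have rhoM i s : rho (i + s%:Z) <= M ^+ s * rho i.
  elim: s => [|s IH]; first by rewrite addr0 mul1r.
  rewrite -addn1 PoszD addrA wprodS// modulusM exprD mulrAC mulrC.
  apply: ler_pM; rewrite ?modulus_ge0//.
  by rewrite expr1 (le_trans (wM0 _))// le_max lexx orbT.
exists (M ^+ q * mod_norm E (mods u) / modulus (u 0)).
  rewrite !mulr_ge0 ?invr_ge0 ?modulus_ge0 ?exprn_ge0//.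
  exact: le_trans (modulus_ge0 _) (modulus_le_norm _ 0).
move=> i; rewrite mulrAC ler_pdivlMr// mul1r.
have qZ : q%:Z != 0 by lia.
have qp : 0 < q%:Z by lia.
pose a := ((i %/ q%:Z)%Z + 1).
(* The first multiple of [q] strictly above [i] is at most [q] steps away. *)
have [s sq aE] : exists2 s : nat, (s <= q)%N & a * q%:Z = i + s%:Z.
  have := divz_eq i q%:Z; have := modz_ge0 i qZ; have := ltz_pmod i qp.
  rewrite /a; move: (i %% _)%Z (i %/ _)%Z => r b rq r0 ->.
  exists (q - `|r|)%N; first by lia.
  rewrite mulrDl mul1r -addrA; congr (_ + _); lia.
rewrite -(gaq a) modulusM mulrAC.
apply: ler_pM; rewrite ?modulus_ge0 ?modulus_le_norm//.
rewrite aE; apply: le_trans (rhoM _ _) _.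
by rewrite ler_wpM2r ?modulus_ge0// ler_weXn2l.
Qed.

(** Sums over windows with an end at 0 are bounded in terms of [rho 0 = 1] and [rho] at the other
    end; the lower bound on [rho] absorbs the 1, and [sum_le_geometric] applies on each
    half-line. *)
Lemma wprod_dichotomy (d : scalar_field R k) : 0 < d ->
  (forall x, pseudotrajectory T d x -> periodic_seq x ->
    exists y, forall j : int, `|x j - iop_pow T j y| < 1) ->
  exists C t : R, [/\ 0 <= C, 0 <= t < 1,
    forall n l : nat, rho n%:Z <= C * t ^+ l * rho (n + l)%N%:Z &
    forall n l : nat, rho (- n%:Z) <= C * t ^+ l * rho (- (n + l)%N%:Z)].
Proof.
move=> d0 /(shadowing_sum_le d0)[D D0 DS].
have [c c0 crho] := wprod_bounded_below.
have rho0 : rho 0 = 1 by rewrite wprod0 modulus1.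
(* The terms [D * c] and [c] absorb the two constants in [bound]; the last [+ 1] there pays for
   [rho 0] in the sums on the left half-line. *)
pose C := D + D * c + c.
have C0 : 0 <= C by rewrite !addr_ge0// mulr_ge0.
have bound i : D * (rho i + 1) + 1 <= C * rho i.
  rewrite /C 2!mulrDl lerD// mulrDr mulr1 lerD2l -mulrA.
  by rewrite -[leLHS]mulr1 ler_wpM2l.
clearbody C; exists (C + 1), (C / (C + 1)); split.
- by rewrite addr_ge0.
- by rewrite divr_ge0 ?addr_ge0//= ltr_pdivrMr ?mul1r ?ltrDl// ltr_wpDl.
- apply: (sum_le_geometric (r := fun n => rho n%:Z) C0) => i.
    exact: modulus_ge0.
  rewrite (reindex_inj rev_ord_inj)/=; apply: le_trans (bound i%:Z).
  rewrite -rho0 -(subrr i%:Z).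
  apply: le_trans (_ : D * (rho i%:Z + rho (i%:Z - i%:Z)) <= _); last first.
    by rewrite lerDl modulus_ge0.
  apply: le_trans (DS i%:Z i); rewrite le_eqVlt; apply/orP; left; apply/eqP.
  apply: eq_bigr => j _; congr (modulus (wprod _)).
  by have := ltn_ord j; lia.
- apply: (sum_le_geometric (r := fun n => rho (- n%:Z)) C0) => i.
    exact: modulus_ge0.
  apply: le_trans (bound (- i%:Z)).
  (* With the term at [-i] added and [rho 0] split off, the sum runs from -1 to [-i], as in
     [DS 0 i]. *)
  apply: (@le_trans _ _ (\sum_(j < i.+1) rho (- j%:Z))).
    by rewrite big_ord_recr/= lerDl modulus_ge0.
  rewrite big_ord_recl/= oppr0 rho0 addrC lerD2r.
  rewrite -rho0; have := DS 0 i; rewrite [0 - i%:Z]sub0r [rho 0 + _]addrC.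
  apply: le_trans; rewrite le_eqVlt; apply/orP; left; apply/eqP.
  by apply: eq_bigr => j _; congr (modulus (wprod _)); rewrite /bump; lia.
Qed.

End dichotomy.

(** * Bounded solutions of the perturbed orbit equation *)

Section green.
Context {R : realType} {k : scalars} {E : seq_space R}.
Context {w : int -> (scalar_field R k)^o} (w_bounded : bounded_fun w)
  (w_inf : 0 < inf (range (fun n => modulus (w n)))).
Local Notation T := (weighted_shift E w_bounded w_inf).
Local Notation rho n := (modulus (wprod (w := w) n)).

(* The solution of v_(j+1) = T v_j + z_j vanishing at coordinate 0: each
   coordinate is a finite sum, from the future of z on the right half-line,
   where T expands, and from its past on the left one, where T contracts. *)
Definition green (z : int -> seqsp k E) (j i : int) : scalar_field R k :=
  (wprod (w := w) i)^-1 * match i with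
  | Posz n => - \sum_(l < n)
      (wprod (w := w) (i - 1 - l%:Z) : scalar_field R k) *
      z (j + l%:Z) (i - 1 - l%:Z)
  | Negz n => \sum_(l < n.+1)
      (wprod (w := w) (i + l%:Z) : scalar_field R k) *
      z (j - 1 - l%:Z) (i + l%:Z)
  end.

(** After multiplication by [wprod i], the sums for [(j + 1, i)] and [(j, i + 1)] have the same
    terms except for [wprod i * z j i]. *)
Lemma green_step z j i :
  green z (j + 1) i = w (i + 1) * green z j (i + 1) + z j i.
Proof.
have p0 := wprod_neq0 w_inf i; apply: (mulfI p0).
have w0 := w_neq0 w_inf (i + 1).
rewrite mulrDr /green wprodS// invfM.
rewrite [w _ * _]mulrA [w _ * _]mulrA mulfV// mul1r !mulVKf//.
case: i p0 w0 => [n|[|n]] _ _.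
- rewrite -PoszD addn1 big_ord_recl opprD /=.
  have -> : n.+1%:Z - 1 - 0%Z = n by lia.
  rewrite addr0 [RHS]addrAC addNr add0r; congr (- _); apply: eq_bigr => l _.
  rewrite /bump/= add1n; congr (wprod _ * z _ _); lia.
(* For [i = -1] the two formulas meet: the sum at coordinate 0 is empty and the one at -1 has a
   single term. *)
- rewrite NegzE addNr /= big_ord0 oppr0 add0r big_ord1.
  by rewrite addrK; congr (_ * z _ _); rewrite /=; lia.
- have -> : Negz n.+1 + 1 = Negz n by lia.
  rewrite big_ord_recl addrC /=; congr (_ + _).
    apply: eq_bigr => l _.
    rewrite /bump/= add1n; congr (wprod _ * z _ _); lia.
  by rewrite addrK; congr (_ * z _ _); rewrite /=; lia.
Qed.

(** The growth bounds make the coefficients of the [l]-th terms in [green] at most [C * t ^ l], so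
    [mod_geometric] dominates [green] by a series of shifted copies of [z]. *)
Lemma green_solution (C t : R) : 0 <= C -> 0 <= t < 1 ->
  (forall n l : nat, rho n%:Z <= C * t ^+ l * rho (n + l)%N%:Z) ->
  (forall n l : nat, rho (- n%:Z) <= C * t ^+ l * rho (- (n + l)%N%:Z)) ->
  exists2 B : R, 0 < B & forall (z : int -> seqsp k E) (d : R),
    (forall j, mod_norm E (mods (z j)) <= d) ->
    exists v : int -> seqsp k E, [/\ forall j, v (j + 1) = T (v j) + z j,
      forall j, mod_norm E (mods (v j)) <= B * d &
      forall p, (forall j, z (j + p) = z j) -> forall j, v (j + p) = v j].
Proof.
move=> C0 t01 rho_right rho_left; have /andP[t0 t1] := t01.
exists (2 * C / (1 - t) + 1) => [|z d zd].
  by rewrite ltr_wpDl// divr_ge0 ?subr_ge0 ?mulr_ge0// ltW.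
have d0 : 0 <= d.
  exact: le_trans (le_trans (modulus_ge0 _) (modulus_le_norm (z 0) 0)) (zd 0).
(* Future and past terms are added so that one sequence dominates both half-lines; hence the factor
   2 in the constant. *)
pose a j (l : nat) i := C * (mods (z (j + l%:Z)) (i + (- 1 - l%:Z)) +
                             mods (z (j - 1 - l%:Z)) (i + l%:Z)).
have a0 j l i : 0 <= a j l i by rewrite mulr_ge0 ?addr_ge0 ?mods_ge0.
have ad j l : mod_mem E (a j l) /\ mod_norm E (a j l) <= C * (d + d).
  have [m1 n1] :=
    mod_shift (- 1 - l%:Z) (mods_ge0 _) (seqsp_mem (z (j + l%:Z))).
  have [m2 n2] := mod_shift l%:Z (mods_ge0 _) (seqsp_mem (z (j - 1 - l%:Z))).
  have [m3 n3] := mod_add (fun=> mods_ge0 _ _) (fun=> mods_ge0 _ _) m1 m2.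
  have [|m4 n4] := mod_scale C0 _ m3.
    by move=> i; rewrite addr_ge0 ?mods_ge0.
  split=> //; apply: le_trans n4 _; rewrite ler_wpM2l// (le_trans n3)// lerD//.
    exact: le_trans n1 (zd _).
  exact: le_trans n2 (zd _).
have green_le j i : modulus (green z j i) <= \sum_(l < `|i|) t ^+ l * a j l i.
  have ri : 0 < rho i by rewrite modulus_gt0 ?wprod_neq0.
  rewrite /green modulusM modulusV mulrC ler_pdivrMr// mulr_suml.
  case: i ri => n ri.
  - rewrite modulusN; apply: le_trans (modulus_sum _ _) _.
    apply: ler_sum => l _; rewrite modulusM.
    have ln := ltn_ord l.
    (* The distance is [l + 1], and the spare factor [t <= 1] is dropped. *)
    have := rho_right (n - 1 - l)%N l.+1.
    have -> : ((n - 1 - l) + l.+1 = n)%N by lia.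
    have -> : (n - 1 - l)%N%:Z = n%:Z - 1 - l%:Z by lia.
    move=> le; apply: (@le_trans _ _ (C * t ^+ l * rho n *
        mods (z (j + l%:Z)) (n%:Z - 1 - l%:Z))).
      rewrite ler_wpM2r ?modulus_ge0//; apply: le_trans le _.
      rewrite ler_wpM2r ?modulus_ge0// ler_wpM2l// exprS ler_piMl ?exprn_ge0//.
      exact: ltW.
    have -> : t ^+ l * a j l n * rho n = C * t ^+ l * rho n *
        (mods (z (j + l%:Z)) (n%:Z - 1 - l%:Z) +
         mods (z (j - 1 - l%:Z)) (n%:Z + l%:Z)).
      by rewrite /a addrA; ring.
    by rewrite ler_wpM2l ?lerDl ?mods_ge0// !mulr_ge0 ?exprn_ge0 ?modulus_ge0.
  - apply: le_trans (modulus_sum _ _) _.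
    apply: ler_sum => l _; rewrite modulusM.
    have ln := ltn_ord l.
    have := rho_left (n.+1 - l)%N l.
    have -> : (n.+1 - l + l = n.+1)%N by lia.
    have -> : - (n.+1 - l)%N%:Z = Negz n + l%:Z by lia.
    rewrite -NegzE => le.
    apply: (@le_trans _ _ (C * t ^+ l * rho (Negz n) *
        mods (z (j - 1 - l%:Z)) (Negz n + l%:Z))).
      by rewrite ler_wpM2r ?modulus_ge0.
    have -> : t ^+ l * a j l (Negz n) * rho (Negz n) =
        C * t ^+ l * rho (Negz n) *
        (mods (z (j + l%:Z)) (Negz n + (- 1 - l%:Z)) +
         mods (z (j - 1 - l%:Z)) (Negz n + l%:Z)).
      by rewrite /a; ring.
    by rewrite ler_wpM2l ?lerDr ?mods_ge0// !mulr_ge0 ?exprn_ge0 ?modulus_ge0.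
have green_mem j : mod_mem E (fun i => modulus (green z j i)) /\
    mod_norm E (fun i => modulus (green z j i)) <= (2 * C / (1 - t) + 1) * d.
  have [m n] := mod_geometric t01 (a0 j) (ad j).
  have le i : 0 <= modulus (green z j i) <= \sum_(l < `|i|) t ^+ l * a j l i.
    by rewrite modulus_ge0 green_le.
  split; first exact: mod_mem_le le m.
  apply: le_trans (mod_norm_le le m) (le_trans n _).
  have -> : C * (d + d) / (1 - t) = 2 * C / (1 - t) * d by ring.
  by set c := 2 * C / _; rewrite mulrDl mul1r lerDl.
have green_in j : (green z j : int -> (scalar_field R k)^o) \in in_space E.
  by apply/asboolP; exact: (green_mem j).1.
pose v j : seqsp k E := Seqsp (green_in j).
exists v; split.
- by move=> j; apply/val_inj/funext => i; exact: green_step.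
- by move=> j; exact: (green_mem j).2.
(* All times in [green] are relative to [j], so a period of [z] is inherited. *)
- move=> p zp j; apply/val_inj/funext => i; rewrite /= /green.
  have zpA (l : int) : z (j + p + l) = z (j + l) by rewrite addrAC zp.
  case: i => n; congr (_ * _); [congr (- _)|]; apply: eq_bigr => l _.
    by rewrite zpA.
  by rewrite -!(addrA _ (- 1)) zpA.
Qed.

(** If [z] is the error of the pseudotrajectory [x] and [v] solves the equation for [z], then
    [x - v] is a true orbit at distance [|v|] from [x]. A period of [x] passes to [z], then to [v]
    and to this orbit. *)
Lemma solution_shadowing (B : R) : 0 < B ->
  (forall (z : int -> seqsp k E) (d : R),
    (forall j, mod_norm E (mods (z j)) <= d) ->
    exists v : int -> seqsp k E, [/\ forall j, v (j + 1) = T (v j) + z j,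
      forall j, mod_norm E (mods (v j)) <= B * d &
      forall p, (forall j, z (j + p) = z j) -> forall j, v (j + p) = v j]) ->
  shadowing T /\ periodic_shadowing T.
Proof.
move=> B0 sol.
suff main (e : scalar_field R k) : 0 < e ->
    exists2 d : scalar_field R k, 0 < d &
    forall x, pseudotrajectory T d x -> exists y,
      (forall j, `|x j - iop_pow T j y| < e) /\
      (forall p : nat, (forall j, x (j + p%:Z) = x j) -> iter p T y = y).
  split=> e /main[d d0 h]; exists d => // x /h[y [xy yp]]; first by exists y.
  by case=> p p0 xp; exists y => //; exists p => //; exact: yp.
move=> /scalar_gt0P[r r0 ->].
have r2 : 0 < r / (2 * B) by rewrite divr_gt0// mulr_gt0.
(* The bound on [v] is not strict; the 2 makes it [r / 2], strictly below [r]. *)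
exists (of_real (r / (2 * B))); first by rewrite -of_real0 ltr_of_real.
move=> x xd; pose z j := x (j + 1) - T (x j).
have [|v [vS vB vp]] := sol z (r / (2 * B)).
  by move=> j; rewrite -(ler_of_real (k := k)) -seqsp_normE /z distrC ltW.
have orbit j : x j - v j = iop_pow T j (x 0 - v 0).
  rewrite (iop_pow_orbit (T := T) (x := fun j => x j - v j))// => {}j.
  by rewrite vS /z iop_sub opprD addrCA opprB [_ + (T _ - _)]addrC subrK addrC.
exists (x 0 - v 0); split=> [j|p xp].
  rewrite -orbit subKr seqsp_normE ltr_of_real; apply: le_lt_trans (vB j) _.
  have -> : B * (r / (2 * B)) = r / 2 by field; rewrite gt_eqF.
  by rewrite ltr_pdivrMr// mulr_natr mulr2n ltrDl.
have zp j : z (j + p%:Z) = z j by rewrite /z addrAC !xp.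
by rewrite -[LHS]/(iop_pow T p%:Z _) -orbit -[p%:Z]add0r xp (vp _ zp).
Qed.

End green.

(** * Equivalence of the two shadowing properties *)

Theorem corollary4p4 (R : realType) (k : scalars) (E : seq_space R)
    (w : int -> (scalar_field R k)^o)
    (w_bounded : bounded_fun w)
    (w_inf : 0 < inf (range (fun n => modulus (w n)))) :
  dense [set x : seqsp k E |
           periodic_point (weighted_shift E w_bounded w_inf) x] ->
  (shadowing (weighted_shift E w_bounded w_inf) <->
   periodic_shadowing (weighted_shift E w_bounded w_inf)).
Proof.
move=> dP; set T := weighted_shift E w_bounded w_inf.
(* Both properties, at tolerance 1, let periodic pseudotrajectories be shadowed by some orbit,
   periodic or not; this common consequence already yields both. *)
suff main (d : scalar_field R k) : 0 < d ->
    (forall x, pseudotrajectory T d x -> periodic_seq x ->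
      exists y, forall j : int, `|x j - iop_pow T j y| < 1) ->
    shadowing T /\ periodic_shadowing T.
  split=> /(_ 1 ltr01)[d d0 h].
    by case: (main d d0) => // x xd _; exact: h.
  by case: (main d d0) => // x xd xp; have [y _] := h x xd xp; exists y.
move=> d0 shad.
have [C [t [C0 t01 rho_right rho_left]]] := wprod_dichotomy dP d0 shad.
have [B B0 sol] :=
  green_solution (E := E) w_bounded w_inf C0 t01 rho_right rho_left.
exact: solution_shadowing B0 sol.
Qed.
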